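(* Let $G$ be a connected graph of order $n\ge 2$ and let $H$ be a non-trivial graph. If no adjacency basis for $H$ is a dominating set of $H$, then $$\operatorname{dim}_A(G\odot H)=n\cdot \operatorname{dim}_A(H)+n-1.$$
   Context: All graphs are finite, simple, undirected; non-trivial means order at least 2. A set $S\subseteq V(H)$ is an adjacency generator for $H$ if for every two distinct $x,y\in V(H)\setminus S$ there exists $s\in S$ with $|N_H(s)\cap\{x,y\}|=1$ ($N_H$ the open neighbourhood); an adjacency basis is an adjacency generator of minimum cardinality, and this cardinality is $\operatorname{dim}_A(H)$. A dominating set $D$ satisfies $\bigcup_{v\in D}N_H[v]=V(H)$. The corona product $G\odot H$ ($G$ of order $n$ with vertices $v_1,\dots,v_n$) consists of $G$ and $n$ disjoint copies $H_1,\dots,H_n$ of $H$, with $v_i$ joined to every vertex of $H_i$. *)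

(* Defs.v *)
From mathcomp Require Import all_boot.

Set Implicit Arguments.
Unset Strict Implicit.
Unset Printing Implicit Defensive.

Record sgraph := SGraph {
  svertex :> finType;
  sedge : rel svertex;
  sedge_sym : symmetric sedge;
  sedge_irrefl : irreflexive sedge }.

Definition graph_order (G : sgraph) : nat := #|svertex G|.

Definition nontrivial (G : sgraph) : bool := 2 <= graph_order G.

Definition connected (G : sgraph) : Prop :=
  forall x y : G, connect (@sedge G) x y.

Section Neighbourhoods.
Variable H : sgraph.

Definition nbhd (s : H) : {set H} := [set x | sedge s x].

Definition cl_nbhd (s : H) : {set H} := s |: nbhd s.

Definition adj_generator (S : {set H}) : bool :=
  [forall x, forall y,
    [&& x != y, x \notin S & y \notin S] ==>
    [exists s in S, #|nbhd s :&: [set x; y]| == 1]].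

(* [setT] is vacuously an adjacency generator, so it is a legitimate starting
   point for the minimisation. *)
Definition dimA : nat :=
  #|[arg min_(S < [set: H] | adj_generator S) #|S|]|.

Definition adj_basis (S : {set H}) : bool :=
  adj_generator S && (#|S| == dimA).

Definition dominating (D : {set H}) : bool :=
  \bigcup_(v in D) cl_nbhd v == [set: H].

End Neighbourhoods.

Lemma adj_generatorT (H : sgraph) : adj_generator [set: H].
Proof. by apply/forallP=> x; apply/forallP=> y; rewrite inE andbF. Qed.

Lemma dimA_min (H : sgraph) :
  (exists2 S : {set H}, adj_generator S & #|S| = dimA H) /\
  (forall S : {set H}, adj_generator S -> dimA H <= #|S|).
Proof.
rewrite /dimA; case: arg_minnP => [|S genS minS]; first exact: adj_generatorT.
by split; [exists S | exact: minS].
Qed.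

Section Corona.
Variables G H : sgraph.

(* [inl v] is the vertex v of G; [inr (v, w)] is the vertex w in the copy of H
   attached to v. *)
Definition corona_vertex : finType := (G + G * H)%type.

Definition corona_edge : rel corona_vertex := fun a b =>
  match a, b with
  | inl u, inl v => sedge u v
  | inl u, inr (v, _) => u == v
  | inr (u, _), inl v => u == v
  | inr (u, x), inr (v, y) => (u == v) && sedge x y
  end.

Lemma corona_edge_sym : symmetric corona_edge.
Proof.
move=> [u|[u x]] [v|[v y]] //=; first exact: sedge_sym.
by rewrite eq_sym sedge_sym.
Qed.

Lemma corona_edge_irrefl : irreflexive corona_edge.
Proof. by move=> [u|[u x]] /=; rewrite sedge_irrefl ?andbF. Qed.

Definition corona : sgraph := SGraph corona_edge_sym corona_edge_irrefl.

End Corona.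

(* Main.v *)
(* In a corona, vertices outside the i-th copy of H do not distinguish two
   vertices of that copy, so the trace of a generator on each copy is a generator
   of H.  If v_i is missed and the trace there has minimum size, then some vertex
   of that copy has no neighbour in the generator; this can happen for at most
   one i, which gives the lower bound.  Conversely, a basis of H in every copy
   together with all but one vertex of G is a generator. *)
Require Import Defs.
From mathcomp Require Import all_boot.
From mathcomp Require Import zify.

(** For [x != y] the neighbourhood of [s] meets [[set x; y]] in the disjoint union of two traces of
    size 0 or 1, so the size is 1 exactly when the two adjacencies differ. *)
Lemma adj_generatorP (H : sgraph) (S : {set H}) :
  reflect (forall x y : H, x != y -> x \notin S -> y \notin S ->
             exists2 s, s \in S & sedge s x != sedge s y)
          (adj_generator S).
Proof.
have sep (s x y : H) : x != y ->
    (#|nbhd s :&: [set x; y]| == 1) = (sedge s x != sedge s y).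
  move=> xy; rewrite setIUr cardsU.
  have -> : nbhd s :&: [set x] :&: (nbhd s :&: [set y]) = set0.
    apply/setP=> z; rewrite !inE; case: eqP => [->|]; rewrite ?andbF //.
    by rewrite (negPf xy) !andbF.
  have card1 z : #|nbhd s :&: [set z]| = sedge s z.
    case: (boolP (sedge s z)) => sz.
      by rewrite (setIidPr _) ?cards1 // sub1set inE.
    by apply/eqP; rewrite cards_eq0 setI_eq0 disjoint_sym disjoints1 inE.
  by rewrite !card1 cards0; case: (sedge s x); case: (sedge s y).
apply: (iffP idP) => [genS x y xy xS yS | genS].
  have := forallP (forallP genS x) y; rewrite xy xS yS /=.
  by case/existsP=> s /andP[sS]; rewrite sep //; exists s.
apply/forallP=> x; apply/forallP=> y; apply/implyP=> /and3P[xy xS yS].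
have [s sS sxy] := genS x y xy xS yS.
by apply/existsP; exists s; rewrite sS sep.
Qed.

(** The empty set separates no pair. This later supplies a basis vertex in every copy. *)
Lemma dimA_gt0 (H : sgraph) : nontrivial H -> 0 < dimA H.
Proof.
move=> hH; have [[S genS <-] _] := dimA_min H.
rewrite card_gt0; apply/negP=> /eqP S0.
have /card_gt1P[x [y [_ _ xy]]] : 1 < #|[set: H]| by rewrite cardsT.
have := adj_generatorP _ _ genS x y xy.
by rewrite S0 !inE => /(_ isT isT)[s]; rewrite inE.
Qed.

Lemma not_dominatingP (H : sgraph) (D : {set H}) :
  ~ dominating D -> exists2 x, x \notin D & forall s, s \in D -> ~~ sedge s x.
Proof.
move/negP; rewrite /dominating -subTset => /subsetPn[x _ xD].
have noD s : s \in D -> x \notin cl_nbhd s.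
  by move=> sD; apply: contra xD => xs; apply/bigcupP; exists s.
exists x => [|s /noD]; last by rewrite !inE => /norP[].
by apply/negP=> /noD; rewrite !inE eqxx.
Qed.

(** A path from [u] to a different vertex starts with an edge at [u]. *)
Lemma connected_neighbour (G : sgraph) (u : G) :
  connected G -> nontrivial G -> exists v, sedge u v.
Proof.
move=> hG /card_gt1P[x [y [_ _ xy]]].
have [w uw] : exists w, u != w.
  by case: (eqVneq u x) => [->|]; [exists y | exists x].
case/connectP: (hG u w) => [[|v p]] /=; first by move=> _ e; rewrite e eqxx in uw.
by case/andP=> uv _ _; exists v.
Qed.

Section CoronaGenerators.
Variables G H : sgraph.
Implicit Types (S : {set corona G H}) (B : {set H}) (u : G).

Definition copy_trace S u : {set H} := [set w | inr (u, w) \in S].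

Lemma card_corona_set S :
  #|S| = \sum_(u : G) ((inl u \in S) + #|copy_trace S u|).
Proof.
rewrite -sum1_card big_mkcond big_sumType /= big_split /=; congr (_ + _).
transitivity (\sum_(u : G) \sum_(w : H) if inr (u, w) \in S then 1 else 0).
  by rewrite pair_bigA /=; apply: eq_bigr => -[].
apply: eq_bigr => u _; rewrite -sum1_card -big_mkcond /=.
by apply: eq_bigl => w; rewrite inE.
Qed.

Lemma copy_trace_generator S u :
  adj_generator S -> adj_generator (copy_trace S u).
Proof.
move=> /adj_generatorP genS; apply/adj_generatorP => x y xy.
rewrite !inE => xS yS.
have xy' : inr (u, x) != inr (u, y) :> corona G H.
  by apply: contra xy => /eqP[->].
(* A vertex of [G] is adjacent to all of the copy at [u] or to none of it, so the separating vertex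
   lies in a copy, necessarily the one at [u]. *)
have [[v|[v w]] sS /=] := genS _ _ xy' xS yS; first by rewrite eqxx.
case: (eqVneq v u) sS => [->|] sS; last by rewrite eqxx.
by exists w; rewrite ?inE.
Qed.

Lemma corona_deficient_unique S u v :
  (forall B, adj_basis B -> ~ dominating B) -> adj_generator S ->
  (inl u \in S) + #|copy_trace S u| <= dimA H ->
  (inl v \in S) + #|copy_trace S v| <= dimA H -> u = v.
Proof.
move=> hB genS hu hv; apply/eqP/negPn/negP=> uv.
(* The trace alone already has at least [dimA H] elements, so the bound excludes [inl t] from [S]
   and makes the trace a basis. A vertex it does not dominate then has no neighbour in [S], and two
   such vertices cannot be separated. *)
have isolated t : (inl t \in S) + #|copy_trace S t| <= dimA H ->
    exists2 x, inr (t, x) \notin S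
             & forall s : corona G H, s \in S -> ~~ sedge s (inr (t, x)).
  move=> ht; have genT := copy_trace_generator _ t genS.
  have [_ /(_ _ genT) leT] := dimA_min H.
  have tS : inl t \notin S by move: ht; case: (_ \in S) => //; lia.
  have bT : adj_basis (copy_trace S t).
    rewrite /adj_basis genT eqn_leq leT andbT.
    exact: leq_trans (leq_addl _ _) ht.
  have [x xT nx] := not_dominatingP _ _ (hB _ bT).
  rewrite inE in xT; exists x => // -[a|[a w]] sS /=.
    by apply: contra tS => /eqP <-.
  apply/negP=> /andP[/eqP ea]; rewrite ea in sS; apply/negP/nx.
  by rewrite inE.
have [x xS nx] := isolated u hu; have [y yS ny] := isolated v hv.
have xy : inr (u, x) != inr (v, y) :> corona G H.
  by apply: contra uv => /eqP[->].
have [s sS] := adj_generatorP _ _ genS _ _ xy xS yS.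
by rewrite (negPf (nx s sS)) (negPf (ny s sS)).
Qed.

Definition corona_lift u B : {set corona G H} :=
  [set a | match a : corona_vertex G H with
           | inl v => v != u
           | inr (_, w) => w \in B
           end].

Lemma corona_lift_generator u B :
  connected G -> nontrivial G -> B != set0 ->
  adj_generator B -> adj_generator (corona_lift u B).
Proof.
move=> hG hG2 /set0Pn[b bB] /adj_generatorP genB; apply/adj_generatorP.
have [t ut] := connected_neighbour _ u hG hG2.
have tu : t != u by apply: contraTneq ut => ->; rewrite sedge_irrefl.
(* Inside the copy at [u], the neighbour [t] of [u] in [G] separates; for any other copy, the vertex
   [b] in the copy at [u] does. *)
have root_copy v w : exists2 s : corona G H, s \in corona_lift u B
    & sedge s (inl u) != sedge s (inr (v, w)).
  have [->|vu] := eqVneq v u.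
    exists (inl t); first by rewrite inE.
    by rewrite /= sedge_sym ut (negPf tu).
  exists (inr (u, b)); first by rewrite inE.
  by rewrite /= eqxx [u == v]eq_sym (negPf vu).
move=> [a|[a x]] [c|[c y]]; rewrite !inE ?negbK.
- by move=> + /eqP ea /eqP ec; rewrite ea ec eqxx.
- by move=> _ /eqP -> _; apply: root_copy.
- move=> _ _ /eqP ->; have [s sS sxy] := root_copy a x.
  by exists s; rewrite // eq_sym.
move=> xy xB yB; have [eac|ac] := eqVneq a c.
  have xy' : x != y by apply: contra xy => /eqP ->; rewrite eac.
  have [s sB sxy] := genB x y xy' xB yB.
  by exists (inr (a, s)); rewrite ?inE //= eac eqxx.
(* For vertices in distinct copies, either root separates them; at most one of the two roots is the
   omitted [u]. *)
have [au|au] := eqVneq a u.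
  exists (inl c); first by rewrite inE -au eq_sym.
  by rewrite /= eqxx [c == a]eq_sym (negPf ac).
exists (inl a); first by rewrite inE.
by rewrite /= eqxx (negPf ac).
Qed.

Lemma card_corona_lift u B :
  #|corona_lift u B| = graph_order G * #|B| + graph_order G - 1.
Proof.
rewrite card_corona_set big_split /=.
have -> : \sum_(v : G) (inl v \in corona_lift u B) = graph_order G - 1.
  rewrite (bigD1 u) //= inE eqxx add0n.
  rewrite (eq_bigr (fun=> 1)) => [|v vu]; last by rewrite inE vu.
  by rewrite sum1_card cardC1 subn1.
rewrite (eq_bigr (fun=> #|B|)) => [|v _]; last first.
  by apply: eq_card => w; rewrite !inE.
rewrite sum_nat_const -/(graph_order G).
(* Subtraction is truncated, so positivity justifies moving [- 1] across the sum. *)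
have : 0 < graph_order G by apply/card_gt0P; exists u.
lia.
Qed.

End CoronaGenerators.

Theorem theorem10 (G H : sgraph) (n : nat)
    (hn : graph_order G = n) (hn2 : 2 <= n) (hG : connected G)
    (hH : nontrivial H)
    (hbasis : forall S : {set H}, adj_basis S -> ~ dominating S) :
  dimA (corona G H) = n * dimA H + n - 1.
Proof.
have hG2 : nontrivial G by rewrite /nontrivial hn.
have [[S genS cardS] minC] := dimA_min (corona G H).
apply/eqP; rewrite eqn_leq; apply/andP; split.
  have [[B genB cardB] _] := dimA_min H.
  have /card_gt0P[u _] : 0 < #|G| by exact: ltnW hG2.
  rewrite -cardB -hn -(card_corona_lift _ _ u); apply: minC.
  apply: corona_lift_generator => //.
  by rewrite -card_gt0 cardB dimA_gt0.
rewrite -cardS card_corona_set.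
pose f u := (inl u \in S) + #|copy_trace _ _ S u|.
rewrite -[leqRHS]/(\sum_(u : G) f u).
(* If some [u] is deficient it is the only one: it contributes at least [dimA H] and each of the
   other [n - 1] vertices at least [dimA H + 1], which adds up to the bound. *)
case: (pickP (fun u => f u <= dimA H)) => [u fu | fgt].
  have fu_ge : dimA H <= f u.
    have [_ minH] := dimA_min H.
    apply: leq_trans (minH _ (copy_trace_generator _ _ _ u genS)) _.
    exact: leq_addl.
  have le_rest : (n - 1) * (dimA H).+1 <= \sum_(v : G | v != u) f v.
    rewrite -hn subn1 -(cardC1 u) -sum_nat_const; apply: leq_sum => v vu.
    rewrite ltnNge; apply: contra vu => fv.
    by apply/eqP; apply: corona_deficient_unique hbasis genS fv fu.
  by rewrite (bigD1 u) //=; move: fu_ge le_rest; nia.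
(* With no deficient vertex the sum exceeds the bound by at least one. *)
have : n * (dimA H).+1 <= \sum_(v : G) f v.
  rewrite -hn -sum_nat_const; apply: leq_sum => v _.
  by rewrite ltnNge fgt.
nia.
Qed.
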